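(* Let $G$ be a finite group, let $*$ be a nonidentical involutory antiautomorphism of $G$ with $gg^*\in Z(G)$ for every $g\in G$, and let $g_0\in Z(G)$ with $g_0^*=g_0$. Let $\beta\in\{xy,\,x^*y,\,yx,\,yx^*\}$, $\gamma\in\{xy,\,yx\}$ and $\delta\in\{g_0xy,\,g_0xy^*,\,g_0x^*y,\,g_0x^*y^*,\,g_0yx,\,g_0yx^*,\,g_0y^*x,\,g_0y^*x^*\}$. Then the loop $L=Q(G,*,g_0,\beta,\gamma,\delta)$ is a right nuclear square loop if and only if at least one of the following holds: (a) $L$ is an RC-loop; (b) $(\beta,\gamma,\delta)$ is among $(xy,xy,g_0x^*y)$, $(x^*y,xy,g_0xy)$, $(x^*y,xy,g_0x^*y)$; (c) $G/Z(G)$ is an elementary abelian $2$-group and $(\beta,\gamma,\delta)$ is among $(xy,xy,g_0yx)$, $(xy,xy,g_0yx^* )$, $(xy,yx,g_0x^*y)$, $(xy,yx,g_0yx)$, $(xy,yx,g_0yx^* )$, $(x^*y,xy,g_0yx)$, $(x^*y,yx,g_0xy)$, $(x^*y,yx,g_0x^*y)$, $(x^*y,yx,g_0yx)$, $(yx,xy,g_0xy)$, $(yx,xy,g_0x^*y)$, $(yx,xy,g_0yx^* )$, $(yx,yx,g_0xy)$, $(yx,yx,g_0x^*y)$, $(yx,yx,g_0yx^* )$, $(yx^*,xy,g_0xy)$, $(yx^*,xy,g_0yx)$, $(yx^*,xy,g_0yx^* )$, $(yx^*,yx,g_0xy)$, $(yx^*,yx,g_0yx)$, $(yx^*,yx,g_0yx^*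 )$; (d) $G/Z(G)$ is an elementary abelian $2$-group, $(xx)^*=xx$ for every $x\in G$, and $(\beta,\gamma,\delta)$ is among $(xy,xy,g_0x^*y^* )$, $(xy,xy,g_0y^*x)$, $(xy,xy,g_0y^*x^* )$, $(xy,yx,g_0x^*y^* )$, $(xy,yx,g_0y^*x)$, $(xy,yx,g_0y^*x^* )$, $(x^*y,xy,g_0xy^* )$, $(x^*y,xy,g_0x^*y^* )$, $(x^*y,xy,g_0y^*x)$, $(x^*y,yx,g_0xy^* )$, $(x^*y,yx,g_0x^*y^* )$, $(x^*y,yx,g_0y^*x)$, $(yx,xy,g_0xy^* )$, $(yx,xy,g_0x^*y^* )$, $(yx,xy,g_0y^*x^* )$, $(yx,yx,g_0xy^* )$, $(yx,yx,g_0x^*y^* )$, $(yx,yx,g_0y^*x^* )$, $(yx^*,xy,g_0xy^* )$, $(yx^*,xy,g_0y^*x)$, $(yx^*,xy,g_0y^*x^* )$, $(yx^*,yx,g_0xy^* )$, $(yx^*,yx,g_0y^*x)$, $(yx^*,yx,g_0y^*x^* )$.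
   Context: $Z(G)$ is the center of $G$. An involutory antiautomorphism $*$ of $G$ satisfies $(g^* )^*=g$ and $(gh)^*=h^*g^*$; nonidentical means $g^*\neq g$ for some $g\in G$. A word such as $yx^*$ or $g_0y^*x$ denotes the function $G\times G\to G$ sending $(x,y)$ to the value of the word. Words are regarded as functions: two words are identified when they define the same function on $G\times G$ (for instance $xy$ and $yx$ when $G$ is commutative), and equality of triples $(\beta,\gamma,\delta)$ means equality of the three functions. Let $Gu=\{gu : g\in G\}$ be a disjoint copy of $G$. The loop $Q(G,*,g_0,\beta,\gamma,\delta)$ is the set $G\cup Gu$ with the multiplication, for $x,y\in G$, $$x\circ y=xy,\quad x\circ yu=\beta(x,y)u,\quad xu\circ y=\gamma(x,y)u,\quad xu\circ yu=\delta(x,y).$$ It is a loop with neutral element $1\in G$. The trivial group counts as an elementary abelian $2$-group. A loop is a right nuclear square loop if it satisfies $x(y(zz))=(xy)(zz)$, and an RC-loop if it satisfies $x((yz)z)=(xy)(zz)$. *)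

(* Defs.v *)
From mathcomp Require Import all_boot all_fingroup all_solvable.

Set Implicit Arguments.
Unset Strict Implicit.
Unset Printing Implicit Defensive.

Local Open Scope group_scope.

Definition is_loop (T : Type) (op : T -> T -> T) (e : T) : Prop :=
  [/\ left_id e op, right_id e op,
      forall a, bijective (fun x => op a x)
    & forall a, bijective (fun x => op x a)].

Definition is_right_nuclear_square_loop (T : Type) (op : T -> T -> T) (e : T)
  : Prop :=
  is_loop op e /\
  forall x y z, op x (op y (op z z)) = op (op x y) (op z z).

Definition is_RC_loop (T : Type) (op : T -> T -> T) (e : T) : Prop :=
  is_loop op e /\
  forall x y z, op x (op (op y z) z) = op (op x y) (op z z).

Definition involutory_antiautomorphism (gT : finGroupType) (star : gT -> gT)
  : Prop :=
  involutive star /\ forall g h, star (g * h) = star h * star g.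

(* Words are functions on pairs. Leibniz equality on {ffun _} is equality of
   functions, so membership in the lists below identifies words that define
   the same function. *)
Notation word gT := {ffun gT * gT -> gT}.

Section Words.

Context (gT : finGroupType) (star : gT -> gT) (g0 : gT).

(* In these names a prime stands for the star. *)
Definition wxy   : word gT := [ffun p => p.1 * p.2].
Definition wxy'  : word gT := [ffun p => p.1 * star p.2].
Definition wx'y  : word gT := [ffun p => star p.1 * p.2].
Definition wx'y' : word gT := [ffun p => star p.1 * star p.2].
Definition wyx   : word gT := [ffun p => p.2 * p.1].
Definition wyx'  : word gT := [ffun p => p.2 * star p.1].
Definition wy'x  : word gT := [ffun p => star p.2 * p.1].
Definition wy'x' : word gT := [ffun p => star p.2 * star p.1].

Definition scale_word (g : gT) (w : word gT) : word gT :=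
  [ffun p => g * w p].

Local Notation "g ** w" := (scale_word g w) (at level 40).

Definition beta_words : seq (word gT) := [:: wxy; wx'y; wyx; wyx'].

Definition gamma_words : seq (word gT) := [:: wxy; wyx].

Definition delta_words : seq (word gT) :=
  [:: g0 ** wxy; g0 ** wxy'; g0 ** wx'y; g0 ** wx'y';
      g0 ** wyx; g0 ** wyx'; g0 ** wy'x; g0 ** wy'x'].

Definition unconditional_triples : seq (word gT * word gT * word gT) :=
  [:: (wxy, wxy, g0 ** wx'y); (wx'y, wxy, g0 ** wxy);
      (wx'y, wxy, g0 ** wx'y)].

Definition abelem_quotient_triples : seq (word gT * word gT * word gT) :=
  [:: (wxy, wxy, g0 ** wyx);   (wxy, wxy, g0 ** wyx');
      (wxy, wyx, g0 ** wx'y);  (wxy, wyx, g0 ** wyx);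
      (wxy, wyx, g0 ** wyx');  (wx'y, wxy, g0 ** wyx);
      (wx'y, wyx, g0 ** wxy);  (wx'y, wyx, g0 ** wx'y);
      (wx'y, wyx, g0 ** wyx);  (wyx, wxy, g0 ** wxy);
      (wyx, wxy, g0 ** wx'y);  (wyx, wxy, g0 ** wyx');
      (wyx, wyx, g0 ** wxy);   (wyx, wyx, g0 ** wx'y);
      (wyx, wyx, g0 ** wyx');  (wyx', wxy, g0 ** wxy);
      (wyx', wxy, g0 ** wyx);  (wyx', wxy, g0 ** wyx');
      (wyx', wyx, g0 ** wxy);  (wyx', wyx, g0 ** wyx);
      (wyx', wyx, g0 ** wyx')].

Definition star_fixed_square_triples : seq (word gT * word gT * word gT) :=
  [:: (wxy, wxy, g0 ** wx'y');  (wxy, wxy, g0 ** wy'x);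
      (wxy, wxy, g0 ** wy'x');  (wxy, wyx, g0 ** wx'y');
      (wxy, wyx, g0 ** wy'x);   (wxy, wyx, g0 ** wy'x');
      (wx'y, wxy, g0 ** wxy');  (wx'y, wxy, g0 ** wx'y');
      (wx'y, wxy, g0 ** wy'x);  (wx'y, wyx, g0 ** wxy');
      (wx'y, wyx, g0 ** wx'y'); (wx'y, wyx, g0 ** wy'x);
      (wyx, wxy, g0 ** wxy');   (wyx, wxy, g0 ** wx'y');
      (wyx, wxy, g0 ** wy'x');  (wyx, wyx, g0 ** wxy');
      (wyx, wyx, g0 ** wx'y');  (wyx, wyx, g0 ** wy'x');
      (wyx', wxy, g0 ** wxy');  (wyx', wxy, g0 ** wy'x);
      (wyx', wxy, g0 ** wy'x'); (wyx', wyx, g0 ** wxy');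
      (wyx', wyx, g0 ** wy'x);  (wyx', wyx, g0 ** wy'x')].

End Words.

(* inl x is the element x of G and inr x is the element xu of Gu; star and g0
   enter the multiplication only through the words beta, gamma and delta. *)
Definition Qmul (gT : finGroupType) (beta gamma delta : word gT)
    (a b : gT + gT) : gT + gT :=
  match a, b with
  | inl x, inl y => inl (x * y)
  | inl x, inr y => inr (beta (x, y))
  | inr x, inl y => inr (gamma (x, y))
  | inr x, inr y => inl (delta (x, y))
  end.

Definition Qone (gT : finGroupType) : gT + gT := inl 1.

(* Main.v *)
(** All squares of the loop lie in [G]: they are the elements [z * z] and
    [delta (z, z)], and the latter is [g0] times [z * z], [z * z^*] or
    [(z * z)^*].  With such an element [w] as the square, the right nuclear
    square law says
      [beta (x, gamma (y, w)) = gamma (beta (x, y), w)],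
      [gamma (x, y * w) = gamma (gamma (x, y), w)] and
      [delta (x, gamma (y, w)) = delta (x, y) * w].
    For each triple of words these identities are either automatic, or
    equivalent to [w] being central, or (when [y] is starred in [delta]) to [w]
    being central and fixed by [*].  Since [g * g^*] is central, all [w] are
    central if and only if [G / Z(G)] is an elementary abelian 2-group.
    Finally, an RC-loop is the same as a right alternative right nuclear square
    loop, and for the triples missing from the lists (b), (c), (d) the
    conditions above force right alternativity. *)

Require Import Defs.
From mathcomp Require Import all_boot all_fingroup all_solvable.

Set Implicit Arguments.
Unset Strict Implicit.
Unset Printing Implicit Defensive.

Local Open Scope group_scope.

(** Putting [x = e] in the RC law gives right alternativity, under which the two laws become the
    same equation. *)
Lemma RC_loopE (T : Type) (op : T -> T -> T) (e : T) :
  is_RC_loop op e <->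
  is_right_nuclear_square_loop op e /\
  forall y z, op (op y z) z = op y (op z z).
Proof.
split=> [[loopT rc] | [[loopT rns] ralt]].
  have [idl _ _ _] := loopT.
  have ralt y z : op (op y z) z = op y (op z z).
    by have := rc e y z; rewrite !idl.
  by split=> //; split=> // x y z; rewrite -ralt rc.
by split=> // x y z; rewrite ralt rns.
Qed.

Lemma mem_center_setT (gT : finGroupType) (w : gT) :
  w \in 'Z([set: gT]) <-> forall x, w * x = x * w.
Proof.
split=> [/centerP[_ cw] x | cw]; first by apply: cw; rewrite inE.
by apply/centerP; split=> [|x _]; [rewrite inE | apply: cw].
Qed.

(** A group in which every square is trivial is already abelian, so only the squares of
    representatives matter. *)
Lemma abelem2_center_quotient (gT : finGroupType) :
  2.-abelem ([set: gT] / 'Z([set: gT])) <->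
  forall z : gT, z * z \in 'Z([set: gT]).
Proof.
have nZ (z : gT) : z \in 'N('Z([set: gT])).
  by apply: subsetP (normal_norm (center_normal _)) _ _; rewrite inE.
split=> [/abelemP-/(_ isT)[_ exp2] z | sqZ].
  apply: coset_idr => //; rewrite morphM //.
  by apply: (exp2 (coset _ z)); apply: mem_quotient; rewrite inE.
apply: exponent2_abelem; apply/exponentP=> _ /morphimP[z _ _ ->].
by rewrite -morphX //; apply: coset_id (sqZ z).
Qed.

(** * Words in [x] and [y], and the sorting of the 64 triples *)

Section Words.

Context (gT : finGroupType) (star : gT -> gT) (g0 : gT).
Context (star_anti : involutory_antiautomorphism star).
Context (star_central : forall g, g * star g \in 'Z([set: gT])).
Context (g0_central : g0 \in 'Z([set: gT])) (g0_star : star g0 = g0).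

Let starK : involutive star := star_anti.1.
Let starM x y : star (x * y) = star y * star x := star_anti.2 x y.

Let star1 : star 1 = 1.
Proof. by apply: (mulgI (star 1)); rewrite -starM !mulg1. Qed.

Let g0C x : g0 * x = x * g0.
Proof. by move/mem_center_setT: g0_central; apply. Qed.

Let starC z : star z * z = z * star z.
Proof.
have /mem_center_setT/(_ z) := star_central z.
by rewrite -mulgA => /mulgI.
Qed.

Lemma star_center w : w \in 'Z([set: gT]) -> star w \in 'Z([set: gT]).
Proof.
move/mem_center_setT=> cw; apply/mem_center_setT=> x.
by rewrite -[x]starK -!starM cw.
Qed.

Local Notation "g ** w" := (scale_word g w) (at level 40).
Local Notation xy := (wxy gT).
Local Notation yx := (wyx gT).
Local Notation x'y := (wx'y star).
Local Notation xy' := (wxy' star).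
Local Notation x'y' := (wx'y' star).
Local Notation yx' := (wyx' star).
Local Notation y'x := (wy'x star).
Local Notation y'x' := (wy'x' star).

(** Only a star on [y] counts, since in the law the square enters [delta] through its second
    argument. *)
Definition starred_delta_words : seq (word gT) :=
  [:: g0 ** xy'; g0 ** x'y'; g0 ** y'x; g0 ** y'x'].

Definition unstarred_delta_words : seq (word gT) :=
  [:: g0 ** xy; g0 ** x'y; g0 ** yx; g0 ** yx'].

Definition squares_central := forall z : gT, z * z \in 'Z([set: gT]).

Definition squares_fixed := forall z : gT, star (z * z) = z * z.

(* Together with [(xy, xy, g0 ** xy)], the triples absent from the three lists
   of the theorem. *)
Definition right_alternative_triples : seq (word gT * word gT * word gT) :=
  [:: (xy, yx, g0 ** xy);     (xy, xy, g0 ** xy');    (xy, yx, g0 ** xy');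
      (x'y, xy, g0 ** yx');   (x'y, yx, g0 ** yx');   (x'y, xy, g0 ** y'x');
      (x'y, yx, g0 ** y'x');  (yx, xy, g0 ** yx);     (yx, yx, g0 ** yx);
      (yx, xy, g0 ** y'x);    (yx, yx, g0 ** y'x);    (yx', xy, g0 ** x'y);
      (yx', yx, g0 ** x'y);   (yx', xy, g0 ** x'y');  (yx', yx, g0 ** x'y')].

(* Membership among words of an abstract group is not decidable by computation,
   so triples are handled through their positions in the lists of words. *)
Definition coded_triple (c : nat * nat * nat) : word gT * word gT * word gT :=
  (nth xy (beta_words star) c.1.1, nth xy (gamma_words gT) c.1.2,
   nth xy (delta_words star g0) c.2).

(** The lists may overlap, as different expressions can define the same function; the claim is only
    that they cover everything. *)
Lemma triple_cases b c d :
    b \in beta_words star -> c \in gamma_words gT ->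
    d \in delta_words star g0 ->
  [\/ (b, c, d) = (xy, xy, g0 ** xy),
      (b, c, d) \in unconditional_triples star g0,
      (b, c, d) \in abelem_quotient_triples star g0
    | (b, c, d) \in star_fixed_square_triples star g0 \/
      (b, c, d) \in right_alternative_triples].
Proof.
pose codes_u := [:: (0, 0, 2); (1, 0, 0); (1, 0, 2)]%N.
pose codes_a :=
  [:: (0, 0, 4); (0, 0, 5); (0, 1, 2); (0, 1, 4); (0, 1, 5); (1, 0, 4);
      (1, 1, 0); (1, 1, 2); (1, 1, 4); (2, 0, 0); (2, 0, 2); (2, 0, 5);
      (2, 1, 0); (2, 1, 2); (2, 1, 5); (3, 0, 0); (3, 0, 4); (3, 0, 5);
      (3, 1, 0); (3, 1, 4); (3, 1, 5)]%N.
pose codes_s :=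
  [:: (0, 0, 3); (0, 0, 6); (0, 0, 7); (0, 1, 3); (0, 1, 6); (0, 1, 7);
      (1, 0, 1); (1, 0, 3); (1, 0, 6); (1, 1, 1); (1, 1, 3); (1, 1, 6);
      (2, 0, 1); (2, 0, 3); (2, 0, 7); (2, 1, 1); (2, 1, 3); (2, 1, 7);
      (3, 0, 1); (3, 0, 6); (3, 0, 7); (3, 1, 1); (3, 1, 6); (3, 1, 7)]%N.
pose codes_r :=
  [:: (0, 1, 0); (0, 0, 1); (0, 1, 1); (1, 0, 5); (1, 1, 5); (1, 0, 7);
      (1, 1, 7); (2, 0, 4); (2, 1, 4); (2, 0, 6); (2, 1, 6); (3, 0, 2);
      (3, 1, 2); (3, 0, 3); (3, 1, 3)]%N.
(* All 64 triples of positions are checked by computation; [map_f] below carries membership over to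
   words. *)
have cover : all (fun i => all (fun j => all (fun k => (i, j, k) \in
    (0, 0, 0)%N :: codes_u ++ codes_a ++ codes_s ++ codes_r)
  (iota 0 8)) (iota 0 2)) (iota 0 4) by [].
move=> /(nthP xy)[i lti <-] /(nthP xy)[j ltj <-] /(nthP xy)[k ltk <-].
rewrite -[(_, _, _)]/(coded_triple (i, j, k)).
have iI : i \in iota 0 4 by rewrite mem_iota.
have jI : j \in iota 0 2 by rewrite mem_iota.
have kI : k \in iota 0 8 by rewrite mem_iota.
have := allP (allP (allP cover i iI) j jI) k kI.
rewrite inE !mem_cat => /predU1P[-> | /or4P[] /(map_f coded_triple)].
- by constructor 1.
- by constructor 2.
- by constructor 3.
- by constructor 4; left.
- by constructor 4; right.
Qed.

(** The product of these ranges also contains [(xy, xy, g0 ** xy)], for which the law holds by the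
    same argument. *)
Lemma unconditional_tripleP b c d :
    (b, c, d) \in unconditional_triples star g0 ->
  [/\ b \in [:: xy; x'y], c = xy & d \in [:: g0 ** xy; g0 ** x'y]].
Proof.
rewrite !in_cons in_nil.
by do ?[case/predU1P => [[-> -> ->]|]] => //; split; rewrite ?inE ?eqxx ?orbT.
Qed.

Lemma abelem_quotient_triple_unstarred b c d :
  (b, c, d) \in abelem_quotient_triples star g0 -> d \in unstarred_delta_words.
Proof.
rewrite !in_cons in_nil.
by do ?[case/predU1P => [[_ _ ->]|]] => //; rewrite ?eqxx ?orbT.
Qed.

Lemma star_fixed_triple_starred b c d :
  (b, c, d) \in star_fixed_square_triples star g0 -> d \in starred_delta_words.
Proof.
rewrite !in_cons in_nil.
by do ?[case/predU1P => [[_ _ ->]|]] => //; rewrite ?eqxx ?orbT.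
Qed.

(* A sufficient condition for the right nuclear square law to force squares to
   be central. *)
Definition noncentral_words (b c d : word gT) :=
  [|| b \in [:: yx; yx'], c == yx
    | d \in [:: g0 ** yx, g0 ** yx' & starred_delta_words]].

Lemma noncentral_starred b c d :
  d \in starred_delta_words -> noncentral_words b c d.
Proof.
by move=> dS; rewrite /noncentral_words 2!(in_cons (_ ** _)) dS !orbT.
Qed.

Lemma noncentral_abelem b c d :
  (b, c, d) \in abelem_quotient_triples star g0 -> noncentral_words b c d.
Proof.
rewrite /noncentral_words !in_cons in_nil.
by do ?[case/predU1P => [[-> -> ->]|]] => //; rewrite ?eqxx ?orbT.
Qed.

Lemma noncentral_right_alternative b c d :
  (b, c, d) \in right_alternative_triples -> noncentral_words b c d.
Proof.
rewrite /noncentral_words !in_cons in_nil.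
by do ?[case/predU1P => [[-> -> ->]|]] => //; rewrite ?eqxx ?orbT.
Qed.

(** * The loop of a fixed triple *)

Section Triple.

Context (beta gamma delta : word gT).
Context (beta_in : beta \in beta_words star).
Context (gamma_in : gamma \in gamma_words gT).
Context (delta_in : delta \in delta_words star g0).

Local Notation op := (Qmul beta gamma delta).

Lemma Q_loop : is_loop op (Qone gT).
Proof.
have beta1 y : beta (1, y) = y.
  by move: beta_in; rewrite !inE => /or4P[] /eqP->;
     rewrite ffunE /= ?star1 ?mul1g ?mulg1.
have gamma1 x : gamma (x, 1) = x.
  by move: gamma_in; rewrite !inE => /orP[] /eqP->;
     rewrite ffunE /= ?mul1g ?mulg1.
have starI := inv_inj starK.
have betaI x : injective (fun y => beta (x, y)).
  by move=> y1 y2; move: beta_in; rewrite !inE => /or4P[] /eqP->;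
     rewrite !ffunE /=; do ?[move/mulgI | move/mulIg].
have betaIl y : injective (fun x => beta (x, y)).
  by move=> x1 x2; move: beta_in; rewrite !inE => /or4P[] /eqP->;
     rewrite !ffunE /=; do ?[move/mulgI | move/mulIg]; do ?move/starI.
have gammaI x : injective (fun y => gamma (x, y)).
  by move=> y1 y2; move: gamma_in; rewrite !inE => /orP[] /eqP->;
     rewrite !ffunE /=; do ?[move/mulgI | move/mulIg].
have gammaIl y : injective (fun x => gamma (x, y)).
  by move=> x1 x2; move: gamma_in; rewrite !inE => /orP[] /eqP->;
     rewrite !ffunE /=; do ?[move/mulgI | move/mulIg].
have deltaI x : injective (fun y => delta (x, y)).
  by move=> y1 y2; move: delta_in; rewrite !inE => /or4P[|||/or4P[|||/orP[]]]
     /eqP->; rewrite !ffunE /= => /mulgI;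
     do ?[move/mulgI | move/mulIg]; do ?move/starI.
have deltaIl y : injective (fun x => delta (x, y)).
  by move=> x1 x2; move: delta_in; rewrite !inE => /or4P[|||/or4P[|||/orP[]]]
     /eqP->; rewrite !ffunE /= => /mulgI;
     do ?[move/mulgI | move/mulIg]; do ?move/starI.
split.
- by case=> x /=; rewrite ?mul1g ?beta1.
- by case=> x /=; rewrite ?mulg1 ?gamma1.
(* [G] is finite, so injectivity of the translations suffices. *)
- move=> a; apply: injF_bij; case: a => x [y1|y1] [y2|y2] //= [];
    by [move/mulgI-> | move/betaI-> | move/gammaI-> | move/deltaI->].
- move=> a; apply: injF_bij; case: a => y [x1|x1] [x2|x2] //= [];
    by [move/mulIg-> | move/betaIl-> | move/gammaIl-> | move/deltaIl->].
Qed.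

(** * Squares in [Gu], and sufficient conditions for the right nuclear square law *)

Lemma delta_diagonal z :
  [\/ delta (z, z) = g0 * (z * z), delta (z, z) = g0 * (z * star z)
    | delta (z, z) = g0 * star (z * z)].
Proof.
by move: delta_in; rewrite !inE => /or4P[|||/or4P[|||/orP[]]] /eqP->;
   rewrite !ffunE /= ?starM ?starC;
   by [constructor 1 | constructor 2 | constructor 3].
Qed.

Lemma delta_diagonal_central z :
  squares_central -> delta (z, z) \in 'Z([set: gT]).
Proof.
move=> sqZ; have g0Z a : a \in 'Z([set: gT]) -> g0 * a \in 'Z([set: gT]).
  exact: (@groupM _ 'Z([set: gT])%G) g0_central.
have [] := delta_diagonal z => ->; apply: g0Z => //.
exact/star_center/sqZ.
Qed.

Lemma delta_diagonal_fixed z :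
  squares_fixed -> star (delta (z, z)) = delta (z, z).
Proof.
move=> sqS; have [] := delta_diagonal z => ->;
by rewrite starM g0_star -g0C ?sqS // starM starK.
Qed.

(** [beta] and [gamma] never star [y], so a central [w] factors out of their second argument; a
    starred [y] in [delta] turns it into [star w]. *)
Lemma right_nuclear_central w :
    w \in 'Z([set: gT]) ->
    delta \in unstarred_delta_words \/ star w = w ->
  forall a b, op a (op b (inl w)) = op (op a b) (inl w).
Proof.
move=> /mem_center_setT cw dw.
have gammaw x y : gamma (x, y * w) = gamma (x, y) * w.
  by move: gamma_in; rewrite !inE => /orP[] /eqP->;
     rewrite !ffunE /= -!mulgA ?cw.
have gammaC x : gamma (x, w) = x * w.
  by move: gamma_in; rewrite !inE => /orP[] /eqP->; rewrite !ffunE /= ?cw.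
have betaw x y : beta (x, y * w) = beta (x, y) * w.
  by move: beta_in; rewrite !inE => /or4P[] /eqP->;
     rewrite !ffunE /= -!mulgA ?cw.
have deltaw x y : delta (x, y * w) = delta (x, y) * w.
  case: dw => [|sw]; first rewrite !inE => /or4P[] /eqP->.
  1-4: by rewrite !ffunE /= -?mulgA ?cw -?mulgA.
  by move: delta_in; rewrite !inE => /or4P[|||/or4P[|||/orP[]]] /eqP->;
     rewrite !ffunE /= ?starM ?sw -?mulgA ?cw -?mulgA ?cw -?mulgA.
by move=> [] x [] y /=; rewrite ?gammaC ?betaw ?gammaw ?deltaw ?mulgA.
Qed.

Lemma right_nuclear_square_central :
    squares_central -> delta \in unstarred_delta_words \/ squares_fixed ->
  is_right_nuclear_square_loop op (Qone gT).
Proof.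
move=> sqZ dS; split=> [|a b []z]; first exact: Q_loop.
  by apply: right_nuclear_central => //; case: dS => [|/(_ z)]; [left | right].
apply: right_nuclear_central; first exact: delta_diagonal_central.
by case: dS => [|sqS]; [left | right; apply: delta_diagonal_fixed].
Qed.

(** The second argument stands last in all three words, so a factor [w] on its right comes out by
    associativity, for any [w] in [G]. *)
Lemma right_nuclear_square_unconditional :
    beta \in [:: xy; x'y] -> gamma = xy -> delta \in [:: g0 ** xy; g0 ** x'y] ->
  is_right_nuclear_square_loop op (Qone gT).
Proof.
move=> bE cE dE; split; first exact: Q_loop.
suff nuc w a b : op a (op b (inl w)) = op (op a b) (inl w).
  by move=> a b []z; apply: nuc.
move: bE dE; rewrite cE !inE => /orP[] /eqP-> /orP[] /eqP->;
by case: a b => x [] y /=; rewrite ?ffunE /= !mulgA.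
Qed.

(** * Necessary conditions, read off from the law at chosen elements *)

Lemma squares_fixed_necessary :
    is_right_nuclear_square_loop op (Qone gT) ->
  delta \in starred_delta_words -> squares_fixed.
Proof.
(* Here the law reduces to [g0 * star (z * z) = g0 * (z * z)]. *)
move=> [_ nuc] dE z; have := nuc (inr 1) (inr 1) (inl z) => /=.
have -> : gamma (1, z * z) = z * z.
  by move: gamma_in; rewrite !inE => /orP[] /eqP->;
     rewrite ffunE /= ?mul1g ?mulg1.
move: dE; rewrite !inE => /or4P[] /eqP->;
by rewrite !ffunE /= ?star1 ?mul1g ?mulg1 => -[] /mulgI.
Qed.

Lemma squares_central_necessary :
    is_right_nuclear_square_loop op (Qone gT) ->
    noncentral_words beta gamma delta ->
  squares_central.
Proof.
move=> rns noncen z; have [_ nuc] := rns.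
apply/mem_center_setT => x; set w := z * z.
move: gamma_in noncen; rewrite /noncentral_words !inE.
case/orP=> /eqP gE; last first.
  have := nuc (inr 1) (inl x) (inl z).
  by rewrite /= gE !ffunE /= !mulg1 => -[].
have delta_w a b : delta (a, b * w) = delta (a, b) * w.
  have gamma_w : gamma (b, w) = b * w by rewrite gE ffunE.
  by have := nuc (inr a) (inr b) (inl z); rewrite /= gamma_w => -[].
have fix_w : delta \in starred_delta_words -> star w = w.
  by move/(squares_fixed_necessary rns); apply.
case/or3P=> [/orP[]/eqP bE | /eqP gE' |].
- have := nuc (inl x) (inr 1) (inl z).
  by rewrite /= gE bE !ffunE /= !mul1g => -[].
- have := nuc (inl (star x)) (inr 1) (inl z).
  by rewrite /= gE bE !ffunE /= starK !mul1g => -[].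
(* This case is not contradictory: [xy] and [yx] are the same function when [G] is commutative. *)
- have := nuc (inr 1) (inl x) (inl z).
  by rewrite /= gE' !ffunE /= !mulg1 => -[].
(* For each of the six words, one of these three instances becomes [g0 * (w * x) = g0 * (x * w)];
   [star x] serves where the word stars that argument. *)
clearbody w; move=> dE; have:= delta_w 1 (star x); have:= delta_w x 1.
have:= delta_w (star x) 1; move: dE fix_w; rewrite !inE.
case/or3P=> [||/or4P[]] /eqP->; rewrite ?eqxx ?orbT => fix_w;
  rewrite !ffunE /= ?starM ?fix_w // ?star1 ?starK ?mul1g ?mulg1;
  rewrite -!mulgA ?mul1g => h1 h2 h3;
  by [move/mulgI: h1 | move/mulgI: h2 | move/mulgI: h3].
Qed.

(** * Right alternativity *)

Lemma right_alternative :
    squares_central -> (delta \in starred_delta_words -> squares_fixed) ->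
    (beta, gamma, delta) \in right_alternative_triples ->
  forall a b, op (op a b) b = op a (op b b).
Proof.
move=> sqZ sqS t_in a b.
(* These rules collect central pairs of factors in [z] to the right of [x], and [g0l], [g0r] bring
   [g0] to the front, so that both sides reach a common form. *)
have zzC (z x : gT) : z * (z * x) = x * (z * z).
  by rewrite mulgA; move/mem_center_setT: (sqZ z); apply.
have zsC (z x : gT) : z * (star z * x) = x * (z * star z).
  by rewrite mulgA; move/mem_center_setT: (star_central z); apply.
have szC z x : star z * (z * x) = x * (z * star z).
  by rewrite mulgA starC -mulgA zsC.
have ssC z x : delta \in starred_delta_words ->
    star z * (star z * x) = x * (z * z).
  by move=> /sqS fixz; rewrite mulgA -starM fixz -mulgA zzC.
have ss z : delta \in starred_delta_words -> star z * star z = z * z.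
  by move=> /sqS fixz; rewrite -starM fixz.
have g0l (x y : gT) : x * (g0 * y) = g0 * (x * y).
  by rewrite mulgA -g0C -mulgA.
have g0r x : x * g0 = g0 * x by rewrite g0C.
have normE := (g0l, g0r, zzC, zsC, szC, starC).
move: t_in; rewrite !in_cons in_nil.
do ?[case/predU1P => [[bE cE dE]|]] => //;
  rewrite dE /starred_delta_words !inE ?eqxx ?orbT in ssC ss;
  case: a b => x [] z /=; congr (_ _);
  rewrite ?bE ?cE ?dE ?ffunE /= ?starM ?g0_star ?starK;
  by rewrite -?mulgA ?normE -?mulgA ?normE ?ssC ?ss.
Qed.

(** All three words are plain products, so beyond associativity only the central [g0] has to be
    moved. *)
Lemma right_alternative_xy :
    (beta, gamma, delta) = (xy, xy, g0 ** xy) ->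
  forall a b, op (op a b) b = op a (op b b).
Proof.
move=> [-> -> ->] [] x [] z /=; rewrite ?ffunE /= ?mulgA //;
by rewrite ?g0C -?mulgA ?g0C.
Qed.

End Triple.

End Words.

Theorem theorem8p14 (gT : finGroupType) (star : gT -> gT) (g0 : gT)
    (beta gamma delta : word gT)
    (star_anti : involutory_antiautomorphism star)
    (star_nonid : exists g, star g <> g)
    (star_central : forall g, (g * star g)%g \in 'Z([set: gT])%g)
    (g0_central : g0 \in 'Z([set: gT])%g)
    (g0_star : star g0 = g0)
    (beta_in : beta \in beta_words star)
    (gamma_in : gamma \in gamma_words gT)
    (delta_in : delta \in delta_words star g0) :
  is_right_nuclear_square_loop (Qmul beta gamma delta) (Qone gT) <->
  [\/ is_RC_loop (Qmul beta gamma delta) (Qone gT),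
      (beta, gamma, delta) \in unconditional_triples star g0,
      (2.-abelem ([set: gT] / 'Z([set: gT])))%g /\
      (beta, gamma, delta) \in abelem_quotient_triples star g0
    | [/\ (2.-abelem ([set: gT] / 'Z([set: gT])))%g,
          forall x : gT, star (x * x)%g = (x * x)%g
        & (beta, gamma, delta) \in star_fixed_square_triples star g0]].
Proof.
split=> [rns | [|tU|[/abelem2_center_quotient sqZ tA]
                  |[/abelem2_center_quotient sqZ sqS _]]].
(* Both facts stay implications until the list containing the triple supplies their premises on the
   words. *)
- have sqS := squares_fixed_necessary star_anti gamma_in rns.
  have sqZ := squares_central_necessary star_anti gamma_in rns.
  have [tE|tU|tA|[tS|tR]] := triple_cases beta_in gamma_in delta_in.
  + by constructor 1; apply/RC_loopE; split=> //;
       apply: right_alternative_xy tE.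
  + by constructor 2.
  + constructor 3; split=> //; apply/abelem2_center_quotient.
    exact: sqZ (noncentral_abelem tA).
  + have dS := star_fixed_triple_starred tS.
    constructor 4; split=> //; last exact: sqS dS.
    by apply/abelem2_center_quotient; apply: sqZ (noncentral_starred _ _ dS).
  + constructor 1; apply/RC_loopE; split=> //.
    have {}sqZ := sqZ _ (noncentral_right_alternative tR).
    by apply: right_alternative tR => //; apply: sqS.
- by case/RC_loopE.
- have [bE cE dE] := unconditional_tripleP tU.
  exact: right_nuclear_square_unconditional bE cE dE.
- apply: (@right_nuclear_square_central _ star g0) => //.
  by left; apply: abelem_quotient_triple_unstarred tA.
- by apply: (@right_nuclear_square_central _ star g0) => //; right.
Qed.
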